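(* Let $K$ be a compact Hausdorff space, let $\mathcal{A}$ be a set of upper semi-continuous functions $K\to[-\infty,\infty)$, and let $\overline{\mathcal{A}}^{\downarrow}$ be the set of pointwise limits of all decreasing sequences of functions in $\mathcal{A}$. Then the set of all closed $\mathcal{A}$-boundaries coincides with the set of all closed $\overline{\mathcal{A}}^{\downarrow}$-boundaries, and the two Shilov boundaries coincide: $$b_{\mathcal{A}}=b_{\overline{\mathcal{A}}^{\downarrow}}\quad\text{and}\quad \check{S}_{\mathcal{A}}=\check{S}_{\overline{\mathcal{A}}^{\downarrow}}.$$
   Context: A function $f:K\to[-\infty,\infty)$ is upper semi-continuous if $\{x\in K: f(x)<c\}$ is open in $K$ for every $c\in\mathbb{R}$; such a function attains its maximum on $K$. For such $f$ put $S(f):=\{x\in K: f(x)=\max_K f\}$. For a set $\mathcal{F}$ of upper semi-continuous functions on $K$, a subset $S\subset K$ is a boundary for $\mathcal{F}$ (an $\mathcal{F}$-boundary) if $S\cap S(f)\neq\emptyset$ for every $f\in\mathcal{F}$. $b_{\mathcal{F}}$ is the set of all closed $\mathcal{F}$-boundaries, and $\check{S}_{\mathcal{F}}:=\bigcap_{S\in b_{\mathcal{F}}}S$ is the Shilov boundary for $\mathcal{F}$. A pointwise limit of a decreasing sequence of upper semi-continuous functions is again upper semi-continuous, so these notions apply to $\overline{\mathcal{A}}^{\downarrow}$. *)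

(* Defs.v *)
From HB Require Import structures.
From mathcomp Require Import all_boot all_order all_algebra.
From mathcomp Require Import boolp classical_sets functions.
From mathcomp Require Import reals ereal topology normedtype sequences.

Set Implicit Arguments.
Unset Strict Implicit.
Unset Printing Implicit Defensive.

Import Order.TTheory GRing.Theory Num.Theory.
Import numFieldNormedType.Exports.

Local Open Scope classical_set_scope.
Local Open Scope ereal_scope.

(* Functions K -> [-oo, +oo) are functions K -> \bar R that avoid +oo. *)
Definition upper_semicontinuous (R : realType) (K : topologicalType)
    (f : K -> \bar R) : Prop :=
  (forall x, f x < +oo) /\ (forall c : R, open [set x | f x < c%:E]).

(* The supremum of the values need not be attained in general; for an upper
   semi-continuous f on a compact nonempty K it is, so it is the maximum of f
   over K. *)
Definition max_on (R : realType) (K : topologicalType) (f : K -> \bar R) :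
  \bar R := ereal_sup (range f).

Definition max_set (R : realType) (K : topologicalType) (f : K -> \bar R) :
  set K := [set x | f x = max_on f].

Definition boundary (R : realType) (K : topologicalType)
    (F : set (K -> \bar R)) (S : set K) : Prop :=
  forall f, F f -> S `&` max_set f !=set0.

Definition closed_boundaries (R : realType) (K : topologicalType)
    (F : set (K -> \bar R)) : set (set K) :=
  [set S | closed S /\ boundary F S].

Definition shilov_boundary (R : realType) (K : topologicalType)
    (F : set (K -> \bar R)) : set K :=
  \bigcap_(S in closed_boundaries F) S.

(* "Decreasing" is meant in the wide sense, so constant sequences are allowed
   and A is contained in its closure. Limits are taken in \bar R, so the value
   -oo is allowed. *)
Definition decreasing_closure (R : realType) (K : topologicalType)
    (A : set (K -> \bar R)) : set (K -> \bar R) :=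
  [set f : K -> \bar R | exists u : nat -> K -> \bar R,
    [/\ forall n, A (u n),
        forall x, nonincreasing_seq (fun n => u n x) &
        forall x, u n x @[n --> \oo] --> f x]].

(* Main.v *)
(** Let [S] be a closed [A]-boundary, let [u n] in [A] decrease to [f] and let
    [M] be the supremum of [f]. Pick a maximum point [x n] of [u n] in [S]; by
    compactness [x] has a cluster point [p] in [S]. If [f p < M], then
    [u k p < M] for some [k], so by upper semi-continuity of [u k] some [n >= k]
    has [M <= max (u n) = u n (x n) <= u k (x n) < M], a contradiction. *)
Require Import Defs.
From HB Require Import structures.
From mathcomp Require Import all_boot all_order all_algebra.
From mathcomp Require Import boolp classical_sets functions.
From mathcomp Require Import reals ereal topology normedtype sequences.

Import Order.TTheory.

Local Open Scope classical_set_scope.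

Lemma sub_decreasing_closure (R : realType) (K : topologicalType)
  (A : set (K -> \bar R)) : A `<=` decreasing_closure A.
Proof.
move=> f Af; exists (fun=> f); split=> // x; last exact: cvg_cst.
by move=> m n _.
Qed.

Lemma boundaryS (R : realType) (K : topologicalType)
  (F G : set (K -> \bar R)) : F `<=` G -> boundary G `<=` boundary F.
Proof. by move=> FG S GS f /FG; exact: GS. Qed.

(** The threshold is extended because it will be the supremum of a limit function, which may be
    [-oo]. There the set is empty; at [+oo] it is everything, since [f] avoids [+oo]. *)
Lemma upper_semicontinuous_open (R : realType) (K : topologicalType)
    (f : K -> \bar R) (c : \bar R) :
  upper_semicontinuous f -> open [set x | (f x < c)%E].
Proof.
move=> [f_lty f_open]; case: c => [c| |]; first exact: f_open.
- rewrite (_ : [set _ | _] = setT); first exact: openT.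
  by apply/seteqP; split=> // x _; exact: f_lty.
- rewrite (_ : [set _ | _] = set0); first exact: open0.
  by apply/seteqP; split=> // x; rewrite /= ltNge leNye.
Qed.

Lemma le_max_on (R : realType) (K : topologicalType) (f g : K -> \bar R) :
  (forall x, (f x <= g x)%E) -> (max_on f <= max_on g)%E.
Proof.
move=> fg; apply: ge_ereal_sup => _ [x _ <-].
by apply: (le_trans (fg x)); apply: ereal_sup_ubound; exists x.
Qed.

Lemma boundary_decreasing_closure (R : realType) (K : topologicalType)
    (A : set (K -> \bar R)) (S : set K) :
  (forall f, A f -> upper_semicontinuous f) -> compact S ->
  boundary A S -> boundary (decreasing_closure A) S.
Proof.
move=> uscA compactS AS f [u [Au u_noninc uf]].
(* Monotonicity turns the limit into an infimum, which yields both [f <= u n] and, later, an index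
   [k] with [u k p < max_on f]. *)
have f_inf y : f y = ereal_inf (range (u ^~ y)).
  apply: (cvg_unique _ (uf y)) => //.
  exact: ereal_nonincreasing_cvgn (u_noninc y).
have f_le n y : (f y <= u n y)%E.
  by rewrite f_inf; apply: ereal_inf_lbound; exists n.
have [x xP] := choice (fun n => AS _ (Au n)).
have [|p [Sp clp]] := compactS (x @ \oo) _.
  by exists 0%N => // n _; case: (xP n).
exists p; split=> //; apply/eqP; rewrite eq_le; apply/andP; split.
  by apply: ereal_sup_ubound; exists p.
rewrite leNgt {1}f_inf; apply/negP => /ereal_inf_lt[_ [k _ <-] ukp].
have ukM_open := upper_semicontinuous_open _ _ _ (max_on f) (uscA _ (Au k)).
(* Since [p] is a cluster point, each tail of [x] meets each neighbourhood of [p], here the open set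
   where [u k < max_on f]. *)
have [|_ [[n kn <-] ukn]] := clp (x @` [set n | (k <= n)%N]) _ _
    (open_nbhs_nbhs (conj ukM_open ukp)).
  by exists k => // n /= kn; exists n.
have : (u n (x n) < max_on f)%E.
  exact: le_lt_trans (u_noninc _ _ _ kn) ukn.
by case: (xP n) => _ ->; rewrite ltNge le_max_on.
Qed.

Theorem corollary2p6 (R : realType) (K : topologicalType)
    (compactK : compact [set: K]) (hausdorffK : hausdorff_space K)
    (A : set (K -> \bar R))
    (uscA : forall f, A f -> upper_semicontinuous f) :
  closed_boundaries A = closed_boundaries (decreasing_closure A) /\
  shilov_boundary A = shilov_boundary (decreasing_closure A).
Proof.
suff eqb : closed_boundaries A = closed_boundaries (decreasing_closure A).
  by split; rewrite // /shilov_boundary eqb.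
apply/seteqP; split=> S [closedS bS]; split=> //.
  apply: boundary_decreasing_closure => //.
  exact: subclosed_compact compactK _.
(* Enlarging a family of functions can only shrink its set of boundaries. *)
exact: boundaryS (@sub_decreasing_closure _ _ A) _ bS.
Qed.
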